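(* Fix an integer $k\geq 1$. For integers $n\ge k$ let $W_{n,k}(x)=\sum_{m=0}^{k}w_{n,k,m}x^m$, where $w_{n,k,m}$ is the number of Dyck paths of semilength $n$ with exactly $k$ occurrences of the factor $UD$ and exactly $m$ occurrences of the factor $UUD$. Then the polynomial sequence $\{W_{n,k}(x)\}_{n\geq k}$ is a generalized Sturm sequence, i.e. $W_{n,k}(x)\preccurlyeq W_{n+1,k}(x)$ for all $n\ge k$.
   Context: A Dyck path of semilength $n$ is a lattice path from $(0,0)$ to $(2n,0)$ with steps $U=(1,1)$ and $D=(1,-1)$ never going below the $x$-axis; it is identified with its word in $\{U,D\}$, and a $UD$-factor (resp. $UUD$-factor) is an occurrence of the consecutive subword $UD$ (resp. $UUD$). Explicitly, $w_{n,k,m}=\frac{1}{k}\binom{n}{k-1}\binom{n-k-1}{m-1}\binom{k}{m}$ if $0<m\le k$ and $k+m\le n$; $w_{n,k,m}=1$ if $m=0$ and $n=k$; and $w_{n,k,m}=0$ otherwise. Each $W_{n,k}(x)$ is real-rooted with nonnegative coefficients. Interlacing: for real-rooted polynomials $F,G$ with nonnegative coefficients, with zeros $\alpha_1\ge\alpha_2\ge\cdots$ of $F$ and $\beta_1\ge\beta_2\ge\cdots$ of $G$, one writes $G\preccurlyeq F$ if either $\deg F=\deg G=n$ and $\beta_n\le\alpha_n\le\beta_{n-1}\le\alpha_{n-1}\le\cdots\le\beta_1\le\alpha_1$, or $\deg F=\deg G+1=n$ and $\alpha_n\le\beta_{n-1}\le\alpha_{n-1}\le\cdots\le\beta_1\le\alpha_1$.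 By convention $a\preccurlyeq bx+c$ for all real $a,b,c$, and $F\preccurlyeq 0$, $0\preccurlyeq F$ for every real-rooted $F$. A sequence $\{F_i(x)\}$ of real-rooted polynomials is a generalized Sturm sequence if $F_i\preccurlyeq F_{i+1}$ for all consecutive indices. *)

(* Defs.v *)
From HB Require Import structures.
From mathcomp Require Import all_boot all_order all_algebra.

Set Implicit Arguments.
Unset Strict Implicit.
Unset Printing Implicit Defensive.

Import Order.TTheory GRing.Theory Num.Theory.
Local Open Scope ring_scope.

(* A lattice path is identified with its word of steps: true is the up step
   U = (1,1), false is the down step D = (1,-1). *)
Notation stepU := true (only parsing).
Notation stepD := false (only parsing).

Definition height (s : seq bool) : int := \sum_(b <- s) (if b then 1 else -1).

Definition dyck (s : seq bool) : bool :=
  (height s == 0) && all (fun i => 0 <= height (take i s)) (iota 0 (size s).+1).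

(* Occurrences of u as a consecutive subword of s, overlaps allowed; meant for
   nonempty u. *)
Definition occ (u s : seq bool) : nat :=
  count (fun i => prefix u (drop i s)) (iota 0 (size s)).

Definition w (n k m : nat) : nat :=
  #|[set p : (n.*2).-tuple bool |
      [&& dyck p, occ [:: stepU; stepD] p == k
        & occ [:: stepU; stepU; stepD] p == m]]|.

Definition W (R : rcfType) (n k : nat) : {poly R} :=
  \sum_(0 <= m < k.+1) (w n k m)%:R *: 'X^m.

(* s lists the zeros of p with multiplicity in weakly decreasing order, and p
   has no other zeros. For p != 0 this determines s, and size s = deg p; for
   p = 0 every sorted s qualifies, so 0 counts as real-rooted. *)
Definition zeros_of (R : rcfType) (p : {poly R}) (s : seq R) : Prop :=
  sorted >=%O s /\ p = lead_coef p *: \prod_(a <- s) ('X - a%:P).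

Definition real_rooted (R : rcfType) (p : {poly R}) : Prop :=
  exists s, zeros_of p s.

Definition nonneg_coefs (R : rcfType) (p : {poly R}) : Prop :=
  forall i, 0 <= p`_i.

(* The relation G ≼ F. With 0-based indices, the chain
   ... <= beta_1 <= alpha_0 reads beta_i <= alpha_i for i < deg G and
   alpha_(i+1) <= beta_i for i + 1 < deg F, both when deg F = deg G and when
   deg F = deg G + 1. The last three clauses are the conventions
   a ≼ bx + c, G ≼ 0 and 0 ≼ F. *)
Definition interlaces (R : rcfType) (G F : {poly R}) : Prop :=
  [\/ [/\ F != 0, G != 0, nonneg_coefs F, nonneg_coefs G &
        (size F = size G \/ size F = (size G).+1) /\
        exists alpha beta : seq R,
          [/\ zeros_of F alpha, zeros_of G beta,
              forall i, (i < size beta)%N -> beta`_i <= alpha`_i &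
              forall i, (i.+1 < size alpha)%N -> alpha`_i.+1 <= beta`_i]],
      exists a b c : R, G = a%:P /\ F = b *: 'X + c%:P,
      F = 0 /\ real_rooted G
    | G = 0 /\ real_rooted F].

(* Only the terms F i with i >= i0 belong to the sequence. *)
Definition generalized_Sturm (R : rcfType) (i0 : nat) (F : nat -> {poly R}) :
    Prop :=
  (forall i, (i0 <= i)%N -> real_rooted (F i)) /\
  (forall i, (i0 <= i)%N -> interlaces (F i) (F i.+1)).

(* Main.v *)
(** Appending a down step to a Dyck path gives a word of length 2n+1 and height
    -1, and by the cycle lemma every such word has exactly one rotation of this
    form. Rotating and cutting at one of the k cyclic factors DU shows that
    k w(n,k,m) counts the words with n U's and n+1 D's that start with U, end
    with D and have k factors UD and m factors UUD, whence
    k w(n,k,m) = C(n,k-1) C(k,m) C(n-k-1,m-1) for n > k.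

    So W_(n,k) is a positive multiple of x Q_r with r = n-k-1 and
    Q_r = sum_j C(k,j+1) C(r,j) x^j = k 2F1(1-k,-r;2;x). Gauss' contiguous
    relation reads
      (r+2) Q_(r+1) = (2r+2 + (k-1-r) x) Q_r + r (x-1) Q_(r-1).
    As x-1 < 0 for x <= 0, Q_(r+1) and Q_(r-1) have opposite signs at the zeros
    of Q_r, and the interlacing follows by induction on r from sign changes. *)

Require Import Defs.
From mathcomp Require Import all_boot all_order all_algebra polyrcf.
From mathcomp Require Import zify ring lra.

Set Implicit Arguments.
Unset Strict Implicit.
Unset Printing Implicit Defensive.

Import Order.TTheory GRing.Theory Num.Theory.

(** * Counting Dyck paths *)

(** Rotation indices are counted, not distinct rotations, so periodic words need no separate
    treatment. *)
Definition cyc (T : Type) (P : pred (seq T)) (s : seq T) : nat :=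
  count (fun i => P (rot i s)) (iota 0 (size s)).

Lemma cyc_comp_rot1 (T : Type) (P : pred (seq T)) (s : seq T) :
  cyc (P \o rot 1) s = cyc P s.
Proof.
rewrite /cyc; case: s => // x s0; set s := x :: s0.
have -> : count (fun i => (P \o rot 1) (rot i s)) (iota 0 (size s)) =
          count (fun i => P (rot i s)) (iota 1 (size s)).
  rewrite -[1%N]addn0 iotaDl count_map; apply: eq_in_count => i.
  by rewrite mem_iota /= => ltis; rewrite -rotS.
have -> : size s = (size s0 + 1)%N by rewrite addn1.
rewrite iotaD count_cat /= add1n addn0 (rot_size s) addn1 /=.
by rewrite rot0 addnC.
Qed.

Lemma cyc_rot (T : Type) (P : pred (seq T)) (n : nat) (s : seq T) :
  cyc P (rot n s) = cyc P s.
Proof.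
have cyc_rot1 s' : cyc P (rot 1 s') = cyc P s'.
  rewrite -[RHS]cyc_comp_rot1 /cyc size_rot; apply: eq_count => i /=.
  by rewrite rot_rot.
elim: n => [|n IHn]; first by rewrite rot0.
have [ltns|lesn] := ltnP n (size s); first by rewrite rotS // cyc_rot1.
by rewrite rot_oversize // ltnW.
Qed.

(* Both sides count the pairs of a word in [P] and a rotation of it in [Q]. *)
Lemma mass_transport (T : finType) (L : nat) (P Q : pred (seq T)) :
  (\sum_(z : L.-tuple T) P z * cyc Q z = \sum_(z : L.-tuple T) Q z * cyc P z)%N.
Proof.
have cycE (F : pred (seq T)) (z : L.-tuple T) :
    cyc F z = (\sum_(i < L) F (rot i z))%N.
  rewrite /cyc size_tuple -sum1_count big_mkcond /= -[L in iota 0 L]subn0.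
  rewrite big_mkord.
  by apply: eq_bigr => i _; case: (F _).
under eq_bigr => z _ do rewrite cycE big_distrr /=.
rewrite exchange_big /=.
(* One extra rotation together with the reversal of indices turns the rotation on the right into one
   by [L - i], the inverse of rotation by [i]. *)
under [RHS]eq_bigr => z _.
  rewrite -(cyc_rot P 1) (cycE P [tuple of rot 1 z]) big_distrr /=.
  rewrite (reindex_inj rev_ord_inj) /=; over.
rewrite [RHS]exchange_big /=; apply: eq_bigr => i _.
have rotK : cancel (fun z : L.-tuple T => [tuple of rot (L - i) z])
                   (fun z : L.-tuple T => [tuple of rot i z]).
  move=> z; apply/val_inj => /=.
  rewrite -[RHS](rotK (L - i)) /rotr size_rot size_tuple subKn ?(ltnW (ltn_ord i)) //.
rewrite (reindex_inj (can_inj rotK)) /=.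
apply: eq_bigr => z _; have /(congr1 val) /= -> := rotK z.
rewrite mulnC; congr (_ * P _)%N.
by rewrite rot_rot -rotS ?subnSK ?size_tuple //; have := ltn_ord i; lia.
Qed.

Local Open Scope ring_scope.

(** * Heights and the cycle lemma *)

Lemma height_cons (b : bool) (s : seq bool) :
  height (b :: s) = (if b then 1 else -1) + height s.
Proof. by rewrite /height big_cons. Qed.

Lemma height_cat (s t : seq bool) : height (s ++ t) = height s + height t.
Proof. by rewrite /height big_cat. Qed.

Lemma height_rcons (s : seq bool) (b : bool) :
  height (rcons s b) = height s + (if b then 1 else -1).
Proof. by rewrite -cats1 height_cat /height big_seq1. Qed.

Lemma height_rot (i : nat) (s : seq bool) : height (rot i s) = height s.
Proof. by rewrite /rot height_cat addrC -height_cat cat_take_drop. Qed.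

Lemma height_count (s : seq bool) :
  height s = (count_mem true s)%:Z - (count_mem false s)%:Z.
Proof.
elim: s => [|b s IHs]; first by rewrite /height big_nil.
by rewrite height_cons IHs; case: b => /=; lia.
Qed.

(* By [first_passage_rcons] below these are the words [pD] with [p] a Dyck path. *)
Definition first_passage (s : seq bool) : bool :=
  (height s == -1) && all (fun i => 0 <= height (take i s)) (iota 0 (size s)).

(** Strictness before [i] will compensate the loss of 1 in height when a rotation wraps around the
    end of the word. *)
Lemma first_argmin (H : nat -> int) (L : nat) : (0 < L)%N ->
  exists i, [/\ (i < L)%N, forall j, (j < i)%N -> H i < H j &
                forall j, (i <= j < L)%N -> H i <= H j].
Proof.
elim: L => // -[_ _|L IHL _].
  by exists 0%N; split=> // -[].
have [//|i [ltiL Hlt Hle]] := IHL.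
have [HL|HL] := ltP (H L.+1) (H i); last first.
  exists i; split=> //; first by lia.
  move=> j /andP[leij]; rewrite ltnS leq_eqVlt => /predU1P[->//|ltjL].
  by apply: Hle; rewrite leij.
exists L.+1; split=> // [j ltjL|j].
  have [ltji|leij] := ltnP j i; first exact: lt_trans HL (Hlt _ ltji).
  by apply: lt_le_trans HL (Hle _ _); rewrite leij.
by rewrite ltnS -eqn_leq => /eqP->.
Qed.

(* Cycle lemma: the rotation must start at the first minimum of the heights. *)
Lemma cyc_first_passage (s : seq bool) :
  height s = -1 -> cyc first_passage s = 1%N.
Proof.
move=> hs; set L := size s.
have L_gt0 : (0 < L)%N.
  by rewrite /L; case: (s) hs => //; rewrite /height big_nil.
(* Each rotation of [s] is a window of length [L] in the doubled word. *)
pose H i := height (take i (s ++ s)).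
have Hrot i j : (i <= L)%N -> (j <= L)%N ->
    height (take j (rot i s)) = H (i + j)%N - H i.
  move=> leiL lejL; rewrite /H takeD height_cat addrAC subrr add0r.
  have -> : take j (rot i s) = take j (take L (drop i (s ++ s))).
    congr take; rewrite drop_cat /rot.
    have [ltiL|geiL] := ltnP i (size s).
      rewrite take_cat size_drop ifN -?leqNgt ?leq_subr //.
      by rewrite subKn.
    have -> : i = size s by apply/eqP; rewrite eqn_leq geiL leiL.
    by rewrite subnn drop0 drop_size /L !take_size.
  by rewrite take_takel.
have HL i : (i <= L)%N -> H (L + i)%N = H i - 1.
  move=> leiL; rewrite /H take_cat ltnNge leq_addr /= addnC addnK height_cat hs.
  rewrite addrC; congr (_ + _); rewrite take_cat; case: ltnP => // geiL.
  have -> : i = size s by apply/eqP; rewrite eqn_leq geiL leiL.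
  by rewrite subnn take0 cats0 take_size.
have fp_rot i : (i < L)%N -> first_passage (rot i s) <->
    (forall j, (j < L)%N -> H i <= H (i + j)%N).
  move=> ltiL; rewrite /first_passage height_rot hs eqxx size_rot /=; split.
    move=> /allP fpi j ltjL; have := fpi j; rewrite mem_iota => /(_ ltjL).
    by rewrite Hrot ?(ltnW ltiL) ?(ltnW ltjL) // subr_ge0.
  move=> Hi; apply/allP => j; rewrite mem_iota => /= ltjL.
  by rewrite Hrot ?(ltnW ltiL) ?(ltnW ltjL) // subr_ge0 Hi.
have [i0 [lti0L Hlt Hle]] := first_argmin H L_gt0.
have Hi0 : forall j, (j < L)%N -> H i0 <= H (i0 + j)%N.
  move=> j ltjL; have [ltijL|leLij] := ltnP (i0 + j) L.
    by apply: Hle; rewrite leq_addr.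
  (* The window has wrapped around to an index before [i0], whose height exceeds [H i0] by at least
     1. *)
  have -> : (i0 + j = L + (i0 + j - L))%N by lia.
  rewrite HL; last lia.
  by have := Hlt (i0 + j - L)%N ltac:(lia); lia.
rewrite /cyc (@eq_in_count _ _ (pred1 i0)); last first.
  move=> i; rewrite mem_iota /= => ltiL.
  apply/idP/eqP => [/(fp_rot _ ltiL) Hi|->{i ltiL}].
    (* Two admissible starts would give [H a <= H b <= H (L + a) = H a - 1]. *)
    have noLater a b : (a < b < L)%N ->
        (forall j, (j < L)%N -> H a <= H (a + j)%N) ->
        (forall j, (j < L)%N -> H b <= H (b + j)%N) -> False.
      move=> /andP[ltab ltbL] /(_ (b - a)%N) Ha /(_ (L - b + a)%N) Hb.
      have := Hb ltac:(lia); have := Ha ltac:(lia).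
      rewrite (_ : a + (b - a) = b)%N; last lia.
      rewrite (_ : b + (L - b + a) = L + a)%N; last lia.
      by rewrite HL; lia.
    case: (ltngtP i i0) => // [ltii0|lti0i].
      by case: (noLater i i0) => //; rewrite ltii0.
    by case: (noLater i0 i) => //; rewrite lti0i.
  exact/fp_rot.
by rewrite count_uniq_mem ?iota_uniq // mem_iota lti0L.
Qed.

(** The proper prefix [p] has height at least 0, so height -1 can only be reached from height 0 by a
    final D. *)
Lemma first_passage_rcons (p : seq bool) (b : bool) :
  first_passage (rcons p b) = ~~ b && dyck p.
Proof.
rewrite /first_passage /dyck height_rcons size_rcons.
rewrite (@eq_in_all _ _ (fun i => 0 <= height (take i p))); last first.
  by move=> i; rewrite mem_iota ltnS /= => leip; rewrite -cats1 takel_cat.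
case: allP => [hp|]; last by rewrite !andbF.
have := hp (size p); rewrite mem_iota ltnSn take_size => /(_ isT).
by case: b => /= hp0; rewrite !andbT ?andbF; lia.
Qed.

(** * Factors of cyclic words *)

Lemma last_drop (T : Type) (x : T) (i : nat) (s : seq T) :
  (i < size s)%N -> last x (drop i s) = last x s.
Proof.
move=> ltis; rewrite -[in RHS](cat_take_drop i s) last_cat.
by case E: (drop i s) => //; move: (size_drop i s); rewrite E /=; lia.
Qed.

Definition UD_or_UUD (u : seq bool) : Prop :=
  u = [:: true; false] \/ u = [:: true; true; false].

(** With default [true], the hypothesis says that [s] is nonempty and ends with D. The only D of [u]
    is its last letter, so a copy of [u] cannot run past that D. *)
Lemma prefix_cat_UD_or_UUD (u s t : seq bool) :
  UD_or_UUD u -> ~~ last true s -> prefix u (s ++ t) = prefix u s.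
Proof.
by case=> ->; case: s => [|[][|[][|[] s]]] //=; rewrite !prefix0s.
Qed.

Definition cocc (u s : seq bool) : nat := cyc (prefix u) s.

(** No occurrence straddles the seam of a word that ends with D. *)
Lemma cocc_occ (u s : seq bool) :
  UD_or_UUD u -> ~~ last true s -> cocc u s = occ u s.
Proof.
move=> uD sD; apply: eq_in_count => i; rewrite mem_iota => /= ltis.
by rewrite prefix_cat_UD_or_UUD // last_drop.
Qed.

Lemma occ_rcons (u p : seq bool) :
  UD_or_UUD u -> ~~ last true p -> occ u (rcons p false) = occ u p.
Proof.
move=> uD pD; rewrite /occ size_rcons -addn1 iotaD count_cat /= add0n addn0.
rewrite drop_rcons // drop_size /= [nat_of_bool _](_ : _ = 0%N) ?addn0; last first.
  by case: uD => ->.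
apply: eq_in_count => i; rewrite mem_iota => /= ltip.
by rewrite drop_rcons ?(ltnW ltip) // -cats1 prefix_cat_UD_or_UUD // last_drop.
Qed.

Lemma occ_cons (u : seq bool) (b : bool) (s : seq bool) :
  occ u (b :: s) = (prefix u (b :: s) + occ u s)%N.
Proof.
rewrite /occ /=; congr (_ + _)%N.
by rewrite -[1%N]addn0 iotaDl count_map.
Qed.

Lemma dyck_last (p : seq bool) : (0 < size p)%N -> dyck p -> ~~ last true p.
Proof.
case/lastP: p => // p b _ /andP[+ /allP /(_ (size p))].
rewrite mem_iota size_rcons /= add0n => + /(_ ltac:(lia)).
rewrite height_rcons last_rcons -cats1 take_size_cat //.
by case: b => //=; lia.
Qed.

(* The places where a cyclic word may be cut between a D and a U. *)
Definition UtoD (s : seq bool) : bool := head false s && ~~ last true s.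

Lemma count_split (T : Type) (a b : pred T) (s : seq T) :
  (count (predI a b) s + count (predI a (predC b)) s = count a s)%N.
Proof. by elim: s => //= x s <-; case: (a x); case: (b x) => /=; lia. Qed.

(* Around a cycle, passages from D to U and from U to D alternate. *)
Lemma cyc_UtoD (s : seq bool) : cyc UtoD s = cocc [:: true; false] s.
Proof.
(* [A] and [B] say that the current and the next letter are U. They hold equally often around the
   cycle, so removing their common part leaves as many DU as UD. *)
pose A := head false : pred (seq bool); pose B := A \o rot 1.
have E1 : cyc (UtoD \o rot 1) s = cyc (predI B (predC A)) s.
  apply: eq_in_count => i; rewrite mem_iota => /= ltis.
  have : (0 < size (rot i s))%N by rewrite size_rot; lia.
  rewrite /B /A /UtoD /=; case: (rot i s) => // x t _.
  by rewrite rot1_cons last_rcons.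
have E2 : cocc [:: true; false] s = cyc (predI A (predC B)) s.
  apply: eq_in_count => i; rewrite mem_iota => /= ltis.
  have : (0 < size (rot i s))%N by rewrite size_rot; lia.
  rewrite /B /A /=; case: (rot i s) => // x t _; rewrite rot1_cons.
  by case: t x => [|[] t] [] //=; rewrite prefix0s.
rewrite -cyc_comp_rot1 E1 E2; apply/eqP.
rewrite -(eqn_add2l (cyc (predI A B) s)) [X in (_ == X)%N]count_split.
rewrite [cyc _ _](_ : _ = cyc (predI B A) s); last first.
  by apply: eq_count => i /=; rewrite andbC.
by rewrite [X in (X == _)%N]count_split -/(cyc B s) cyc_comp_rot1.
Qed.

Definition udclass (k m : nat) (s : seq bool) : bool :=
  [&& height s == -1, cocc [:: true; false] s == k
    & cocc [:: true; true; false] s == m].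

Lemma udclass_rot (k m i : nat) (s : seq bool) :
  udclass k m (rot i s) = udclass k m s.
Proof. by rewrite /udclass height_rot /cocc !cyc_rot. Qed.

(** The bijection appends D to a Dyck path. A nonempty path already ends with D, so this creates no
    factor and cyclic counts agree with linear ones. *)
Lemma w_first_passage (n k m : nat) : (0 < n)%N ->
  w n k m = #|[set y : (n.*2).+1.-tuple bool | udclass k m y && first_passage y]|.
Proof.
move=> n_gt0; rewrite /w.
have rcI : injective (fun p : (n.*2).-tuple bool => [tuple of rcons p false]).
  by move=> p q /(congr1 val) /= /rcons_inj[] /val_inj.
rewrite -(card_imset _ rcI); apply: eq_card => y; rewrite inE.
have key (p : (n.*2).-tuple bool) :
    udclass k m (rcons p false) && first_passage (rcons p false) =
    [&& dyck p, occ [:: true; false] p == k & occ [:: true; true; false] p == m].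
  rewrite first_passage_rcons /= andbC; case: (boolP (dyck p)) => //= dp.
  have pD : ~~ last true p by apply: dyck_last => //; rewrite size_tuple; lia.
  have hp : height (rcons p false) = -1.
    by rewrite height_rcons; case/andP: dp => /eqP->.
  by rewrite /udclass hp !cocc_occ ?last_rcons ?occ_rcons //; (by left) || by right.
apply/imsetP/idP => [[p]|yP]; first by rewrite inE -key => pP ->.
case/lastP E: (tval y) (size_tuple y) => [|p b] //.
rewrite size_rcons => -[/eqP sp].
move: yP; rewrite E first_passage_rcons; case: b E => [|] E; first by rewrite /= andbF.
move=> yP; exists (Tuple sp); last exact/val_inj.
by rewrite inE -key first_passage_rcons.
Qed.

(** Double counting: around each word of the class, one rotation index gives a first passage and [k]
    give a word that starts with U and ends with D. *)
Lemma w_UtoD (n k m : nat) : (0 < n)%N ->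
  (k * w n k m = #|[set z : (n.*2).+1.-tuple bool | udclass k m z && UtoD z]|)%N.
Proof.
move=> n_gt0; rewrite w_first_passage //.
have cardE (P : pred (seq bool)) :
    #|[set z : (n.*2).+1.-tuple bool | P z]| =
    (\sum_(z : (n.*2).+1.-tuple bool) P z)%N.
  rewrite -sum1_card big_mkcond /=; apply: eq_bigr => z _.
  by rewrite inE; case: (P z).
have cycI (P : pred (seq bool)) z :
    cyc (predI (udclass k m) P) z = (udclass k m z * cyc P z)%N.
  rewrite /cyc; case: (boolP (udclass k m z)) => cz.
    by rewrite mul1n; apply: eq_count => i /=; rewrite udclass_rot cz.
  rewrite mul0n -[RHS](count_pred0 (iota 0 (size z))).
  by apply: eq_count => i /=; rewrite udclass_rot (negPf cz).
have /= -> := cardE (fun z => udclass k m z && UtoD z).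
have /= -> := cardE (fun z => udclass k m z && first_passage z).
transitivity (\sum_(z : (n.*2).+1.-tuple bool) predI (udclass k m) UtoD z *
    cyc (predI (udclass k m) first_passage) z)%N.
  rewrite mass_transport big_distrr /=; apply: eq_bigr => z _.
  rewrite cycI cyc_UtoD; case: (boolP (udclass k m z)) => [/and3P[_ /eqP-> _]|] /=.
    by case: first_passage; lia.
  by rewrite muln0.
apply: eq_bigr => z _; rewrite cycI /=; case: (boolP (udclass k m z)) => //= cz.
by rewrite cyc_first_passage ?muln1 //; case/and3P: cz => /eqP.
Qed.

(** * Counting words letter by letter *)

(** Splitting on the first letter is built in, so the recurrences below come by computation;
    [card_cnt] links this to cardinalities. *)
Fixpoint cnt (L : nat) (P : pred (seq bool)) : nat :=
  if L is L'.+1 then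
    (cnt L' (fun s => P (true :: s)) + cnt L' (fun s => P (false :: s)))%N
  else P [::].

Lemma eq_cnt (L : nat) (P Q : pred (seq bool)) : 
  (forall s, size s = L -> P s = Q s) -> cnt L P = cnt L Q.
Proof.
elim: L P Q => [|L IHL] P Q PQ /=; rewrite ?PQ //.
by congr (_ + _)%N; apply: IHL => s sL; rewrite PQ //= sL.
Qed.

Lemma cnt0 (L : nat) (P : pred (seq bool)) : P =1 pred0 -> cnt L P = 0%N.
Proof. by elim: L P => [|L IHL] P P0 /=; rewrite ?P0 // !IHL // => s; apply: P0. Qed.

Lemma card_cnt (L : nat) (P : pred (seq bool)) :
  #|[set z : L.-tuple bool | P z]| = cnt L P.
Proof.
rewrite cardsE -sum1_card big_mkcond /=.
elim: L P => [|L IHL] P.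
  rewrite (big_pred1 [tuple]) => [|z]; last by rewrite [z]tuple0; apply/esym/eqP.
  by rewrite unfold_in /=; case: (P _).
rewrite (reindex (fun bt : bool * L.-tuple bool => [tuple of bt.1 :: bt.2])) /=.
  rewrite -(pair_bigA _ (fun b (t : L.-tuple bool) =>
    if [tuple of b :: t] \in (fun z : L.+1.-tuple bool => P z) then 1%N else 0%N)) /=.
  rewrite big_bool /= -!IHL.
  by congr (_ + _)%N; apply: eq_bigr => t _; rewrite !unfold_in.
exists (fun z => (thead z, [tuple of behead z])) => [[b t] _|z _] /=.
  by congr pair; apply: val_inj.
by rewrite -tuple_eta.
Qed.

(* Words [s] with [u] up and [d] down steps such that [q ++ s] ends with a down
   step; factors are counted in [q ++ s]. *)
Definition completions (q : seq bool) (u d k m : nat) : nat :=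
  cnt (u + d) (fun s => [&& count_mem true s == u, count_mem false s == d,
    ~~ last true (q ++ s), occ [:: true; false] (q ++ s) == k
    & occ [:: true; true; false] (q ++ s) == m]).

Lemma completionsS (q : seq bool) (u d k m : nat) : (0 < u + d)%N ->
  completions q u d k m =
  ((if u is u'.+1 then cnt (u' + d) (fun s =>
      [&& count_mem true s == u', count_mem false s == d,
       ~~ last true (q ++ true :: s), occ [:: true; false] (q ++ true :: s) == k
       & occ [:: true; true; false] (q ++ true :: s) == m]) else 0) +
   (if d is d'.+1 then cnt (u + d') (fun s =>
      [&& count_mem true s == u, count_mem false s == d',
       ~~ last true (q ++ false :: s), occ [:: true; false] (q ++ false :: s) == k
       & occ [:: true; true; false] (q ++ false :: s) == m]) else 0))%N.
Proof.
rewrite /completions; case E: (u + d)%N => [|L] //= _; congr (_ + _)%N.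
  case: u E => [|u] E; first by apply: cnt0.
  have -> : L = (u + d)%N by lia.
  by apply: eq_cnt => s _; rewrite /= ?add1n ?add0n ?eqSS.
case: d E => [|d] E; first by apply: cnt0 => s /=; rewrite andbF.
have -> : L = (u + d)%N by lia.
by apply: eq_cnt => s _; rewrite /= ?add1n ?add0n ?eqSS.
Qed.

(* The number of compositions of [v] into [m] positive parts. *)
Definition ncomp (v m : nat) : nat :=
  match v, m with
  | v'.+1, m'.+1 => 'C(v', m')
  | 0, 0 => 1
  | _, _ => 0
  end.

(* The number of compositions of [u] into [k] positive parts, exactly [m] of
   which are at least 2. *)
Definition ncomp2 (u k m : nat) : nat :=
  if (u < k)%N then 0%N else ('C(k, m) * ncomp (u - k) m)%N.

(** The prefixes D, U and UU act as states of an automaton. A leading D starts no factor and can be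
    forgotten. *)
Lemma completions_D (u d k m : nat) : (0 < u + d)%N ->
  completions [:: false] u d k m =
  ((if u is u'.+1 then completions [:: true] u' d k m else 0) +
   (if d is d'.+1 then completions [:: false] u d' k m else 0))%N.
Proof.
move=> ud_gt0; rewrite completionsS //; congr (_ + _)%N.
  by case: u {ud_gt0} => // u; apply: eq_cnt => s _ /=; rewrite !(occ_cons _ false).
by case: d {ud_gt0} => // d; apply: eq_cnt => s _ /=; rewrite !(occ_cons _ false).
Qed.

Lemma completions_U (u d k m : nat) : (0 < u + d)%N ->
  completions [:: true] u d k m =
  ((if u is u'.+1 then completions [:: true; true] u' d k m else 0) +
   (if (d, k) is (d'.+1, k'.+1) then completions [:: false] u d' k' m else 0))%N.
Proof.
move=> ud_gt0; rewrite completionsS //; congr (_ + _)%N.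
case: d {ud_gt0} => // d; case: k => [|k].
  by apply: cnt0 => s /=; rewrite !(occ_cons _ true) /= prefix0s !andbF.
apply: eq_cnt => s _ /=; rewrite !(occ_cons _ true) /= prefix0s.
by rewrite add1n eqSS.
Qed.

Lemma completions_UU (u d k m : nat) : (0 < u + d)%N ->
  completions [:: true; true] u d k m =
  ((if u is u'.+1 then completions [:: true; true] u' d k m else 0) +
   (if (d, k, m) is (d'.+1, k'.+1, m'.+1)
    then completions [:: false] u d' k' m' else 0))%N.
Proof.
move=> ud_gt0; rewrite completionsS //; congr (_ + _)%N.
  case: u {ud_gt0} => // u; apply: eq_cnt => s _ /=.
  by rewrite !(occ_cons _ true [:: true, true & s]) /= !add0n.
case: d {ud_gt0} => // d; case: k => [|k].
  by apply: cnt0 => s /=; rewrite !(occ_cons _ true) /= prefix0s !andbF.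
case: m => [|m].
  by apply: cnt0 => s /=; rewrite !(occ_cons _ true) /= prefix0s !andbF.
apply: eq_cnt => s _ /=; rewrite !(occ_cons _ true) /= prefix0s.
by rewrite !add0n !add1n !eqSS.
Qed.

(** Run lengths explain the formulas. After D, the D's form a possibly empty initial run and [k]
    nonempty ones, in ['C(d, k)] ways. After U, there is no initial run of D's and the prefix adds
    one U to the first run. After UU, the first run is already long: [m'] of the other [k'] runs are
    long, and the [u - k'] spare U's are shared between these and the first run. *)
Lemma completionsE (L u d k m : nat) : (u + d = L)%N ->
  [/\ completions [:: false] u d k m = ('C(d, k) * ncomp2 u k m)%N,
      completions [:: true] u d k m =
        (if (k, d) is (k'.+1, d'.+1) then 'C(d', k') * ncomp2 u.+1 k m else 0)%N &
      completions [:: true; true] u d k m =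
        (if (k, d, m) is (k'.+1, d'.+1, m'.+1) then
           if (u < k')%N then 0 else 'C(d', k') * ('C(k', m') * 'C(u - k', m'))
         else 0)%N].
Proof.
elim: L u d k m => [|L IHL] u d k m.
  case: u d => [|u] [|d] // _; rewrite /completions /= /ncomp2.
  split; last 2 first.
  - by case: k.
  - by case: k.
  by case: k m => [|k] [|m].
move=> E; have pos : (0 < u + d)%N by rewrite E.
split.
- rewrite completions_D //.
  have -> : (if d is d'.+1 then completions [:: false] u d' k m else 0)%N =
            (if d is d'.+1 then 'C(d', k) * ncomp2 u k m else 0)%N.
    by case: d E {pos} => // d E; have [] := IHL u d k m ltac:(lia).
  have -> : (if u is u'.+1 then completions [:: true] u' d k m else 0)%N =
     (if (u, k, d) is (_.+1, k'.+1, d'.+1) then 'C(d', k') * ncomp2 u k m else 0)%N.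
    by case: u E {pos} => // u E; have [_ ->] := IHL u d k m ltac:(lia).
  case: k => [|k].
    case: d E pos => [|d] E pos; last by case: u {E pos} => [|u]; rewrite !bin0.
    by case: u {E} pos => // u _; rewrite /ncomp2 /=; case: m => [|m].
  case: d E pos => [|d] E pos; last by case: u {E pos} => [|u]; rewrite ?binS /ncomp2 /=; lia.
  by case: u {E pos}.
- rewrite completions_U //.
  have -> : (if (d, k) is (d'.+1, k'.+1) then completions [:: false] u d' k' m else 0)%N
          = (if (d, k) is (d'.+1, k'.+1) then 'C(d', k') * ncomp2 u k' m else 0)%N.
    by case: d E {pos} => // d E; case: k => // k; have [] := IHL u d k m ltac:(lia).
  have -> : (if u is u'.+1 then completions [:: true; true] u' d k m else 0)%N =
     (if (u, k, d, m) is (u'.+1, k'.+1, d'.+1, m'.+1) then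
       if (u' < k')%N then 0 else 'C(d', k') * ('C(k', m') * 'C(u' - k', m'))
      else 0)%N.
    by case: u E {pos} => // u E; have [_ _ ->] := IHL u d k m ltac:(lia).
  case: k => [|k]; first by case: u {E pos} => //; case: d.
  case: d {E pos} => [|d]; first by case: u.
  rewrite /ncomp2 ltnS subSS; case: ltnP => [ltuk|leku].
    by case: u ltuk => [|u] ltuk; case: m => // m; rewrite ifT //; lia.
  case: u leku => [|u] leku.
    have -> : k = 0%N by lia.
    by case: m => [|m]; rewrite //= !muln0.
  case: m => [|m]; first by rewrite !bin0; lia.
  case: ltnP => [ltuk|leku'].
    have -> : (u.+1 - k = 0)%N by lia.
    by rewrite /= !muln0.
  (* Pascal's rule for the choice of long runs: the first run either stays a single U or becomes
     long. *)
  by rewrite subSn //= binS; lia.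
rewrite completions_UU //.
have -> : (if (d, k, m) is (d'.+1, k'.+1, m'.+1)
           then completions [:: false] u d' k' m' else 0)%N
        = (if (d, k, m) is (d'.+1, k'.+1, m'.+1)
           then 'C(d', k') * ncomp2 u k' m' else 0)%N.
  case: d E {pos} => // d E; case: k => // k; case: m => // m.
  by have [] := IHL u d k m ltac:(lia).
have -> : (if u is u'.+1 then completions [:: true; true] u' d k m else 0)%N =
   (if (u, k, d, m) is (u'.+1, k'.+1, d'.+1, m'.+1) then
     if (u' < k')%N then 0 else 'C(d', k') * ('C(k', m') * 'C(u' - k', m'))
    else 0)%N.
  by case: u E {pos} => // u E; have [_ _ ->] := IHL u d k m ltac:(lia).
case: k => [|k]; first by case: u {E pos} => //; case: d.
case: d {E pos} => [|d]; first by case: u.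
case: m => [|m]; first by case: u.
rewrite /ncomp2; case: ltnP => [ltuk|leku].
  by case: u ltuk => [|u] ltuk; rewrite ?ifT //; lia.
case: u leku => [|u] leku.
  have -> : k = 0%N by lia.
  by case: m => [|m]; rewrite //= !muln0.
case: ltnP => [ltuk|leku'].
  have -> : (u.+1 - k = 0)%N by lia.
  by case: m.
rewrite subSn //=; case: m => [|m]; first by rewrite !bin0; lia.
by rewrite binS; lia.
Qed.

(** The words of [w_UtoD] are the completions of the prefix U by [n.-1] letters U and [n.+1] letters
    D. *)
Lemma w_formula (n k m : nat) : (0 < k <= n)%N ->
  (k * w n k m = 'C(n, k.-1) * ncomp2 n k m)%N.
Proof.
move=> /andP[k_gt0 lekn]; have n_gt0 : (0 < n)%N by lia.
have /= -> := w_UtoD k m n_gt0.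
have /= -> := card_cnt (n.*2).+1 (fun z => udclass k m z && UtoD z).
have [_ + _] := @completionsE (n.-1 + n.+1) n.-1 n.+1 k m erefl.
rewrite prednK //; case: k k_gt0 {lekn} => // k _ <-.
rewrite [X in (_ + X)%N]cnt0 => [|s]; last by rewrite /UtoD /= andbF.
have Ln : (n.-1 + n.+1 = n.*2)%N by lia.
rewrite addn0 /completions Ln; apply: eq_cnt => s sL.
rewrite /udclass /UtoD height_cons /= andbC.
case: (boolP (last true s)) => /= [_|sD]; first by rewrite !andbF.
rewrite !cocc_occ //; [|by right|by left]; rewrite [RHS]andbA; congr (_ && _).
(* Length and height together determine the number of U's and of D's. *)
have := height_count s; have := count_predC (pred1 true) s.
rewrite (@eq_count _ (predC (pred1 true)) (pred1 false)); last by case.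
rewrite sL => /= cs hs.
by rewrite hs; apply/eqP/andP => [|[]]; lia.
Qed.

(** * Zeros *)

(* Up to a positive constant and a factor ['X], this is [W R n k.+1] with
   [n = k + r + 2]. *)
Definition Wred (R : rcfType) (k r : nat) : {poly R} :=
  \poly_(j < (minn r k).+1) ('C(k.+1, j.+1) * 'C(r, j))%:R.

Lemma coef_Wred (R : rcfType) (k r j : nat) :
  (Wred R k r)`_j = ('C(k.+1, j.+1) * 'C(r, j))%:R.
Proof.
rewrite coef_poly ltnS leq_min; case: (leqP j r) => [lejr|ltrj] /=.
  by case: leqP => // ltkj; rewrite bin_small.
by rewrite (bin_small ltrj) muln0.
Qed.

Lemma size_Wred (R : rcfType) (k r : nat) : size (Wred R k r) = (minn r k).+1.
Proof.
apply: size_poly_eq; rewrite pnatr_eq0 -lt0n muln_gt0 !bin_gt0 ltnS.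
by rewrite geq_minr geq_minl.
Qed.

Lemma lead_coef_Wred_gt0 (R : rcfType) (k r : nat) : 0 < lead_coef (Wred R k r).
Proof.
rewrite lead_coefE size_Wred coef_Wred ltr0n muln_gt0 !bin_gt0 ltnS.
by rewrite geq_minr geq_minl.
Qed.

(** Gauss' contiguous relation, with [k] and [r] both shifted by one. On coefficients it follows
    from two-term relations between neighbouring binomials. *)
Lemma Wred_rec (R : rcfType) (k r : nat) :
  r.+3%:R *: Wred R k r.+2 =
  (2 * r.+2%:R) *: Wred R k r.+1 + (k%:R - r.+1%:R) *: ('X * Wred R k r.+1) +
  r.+1%:R *: ('X * Wred R k r - Wred R k r).
Proof.
apply/polyP => j.
rewrite !(coefZ, coefD, coefB, coefN, coefXM, coef_Wred).
case: j => [|j] /=.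
  by rewrite !bin0 !muln1 !bin1; ring.
(* Subtraction is taken in the ring: where it turns negative, the binomial it multiplies is 0. *)
have e1 : (j.+2%:R * 'C(k.+1, j.+2)%:R = (k%:R - j%:R) * 'C(k.+1, j.+1)%:R :> R).
  have := mul_bin_left k.+1 j.+1; rewrite -natrM => ->; rewrite natrM.
  have [lejk|ltkj] := leqP j k; first by rewrite subSS natrB.
  by rewrite bin_small ?mulr0 //; lia.
have e2 : (j.+1%:R * 'C(r.+1, j.+1)%:R = (r.+1%:R - j%:R) * 'C(r.+1, j)%:R :> R).
  have := mul_bin_left r.+1 j; rewrite -natrM => ->; rewrite natrM.
  have [lejk|ltkj] := leqP j r.+1; first by rewrite natrB.
  by rewrite bin_small ?mulr0 //; lia.
have e3 : (r.+1%:R * 'C(r, j)%:R = j.+1%:R * 'C(r.+1, j.+1)%:R :> R).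
  by rewrite -!natrM mul_bin_diag.
have e4 : (r.+1%:R * 'C(r, j.+1)%:R = (r.+1%:R - j.+1%:R) * 'C(r.+1, j.+1)%:R :> R).
  have := mul_bin_down r.+1 j.+1; rewrite /= -natrM => ->; rewrite natrM.
  have [lejk|ltkj] := leqP j.+1 r.+1; first by rewrite natrB.
  by rewrite bin_small ?mulr0 //; lia.
rewrite (binS r.+1 j) !natrM natrD.
move: e1 e2 e3 e4.
set a := 'C(k.+1, j.+2)%:R; set b := 'C(k.+1, j.+1)%:R.
set c := 'C(r.+1, j.+1)%:R; set d := 'C(r.+1, j)%:R.
set e := 'C(r, j)%:R; set f := 'C(r, j.+1)%:R => e1 e2 e3 e4.
apply/eqP; rewrite -subr_eq0; apply/eqP.
(* The difference of the two sides as an explicit combination of [e1], [e2], [e3], [e4]. *)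
transitivity (d * (j.+2%:R * a - (k%:R - j%:R) * b)
  - (a + b) * (j.+1%:R * c - (r.+1%:R - j%:R) * d)
  - b * (r.+1%:R * e - j.+1%:R * c)
  + a * (r.+1%:R * f - (r.+1%:R - j.+1%:R) * c)); first by ring.
by rewrite e1 e3 e4 e2 !subrr !mulr0 !subrr addr0.
Qed.

(** * Zeros from sign changes *)

Lemma prod_XsubC_sign (R : rcfType) (s : seq R) (x : R) (i : nat) :
  (i <= size s)%N ->
  (forall j, (j < i)%N -> x < s`_j) ->
  (forall j, (i <= j < size s)%N -> s`_j < x) ->
  0 < (-1) ^+ i * (\prod_(a <- s) ('X - a%:P)).[x].
Proof.
elim: s i => [|a s IHs] i /=.
  by rewrite leqn0 => /eqP-> _ _; rewrite big_nil hornerC mulr1.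
rewrite big_cons hornerM hornerXsubC; case: i => [_ _ sx|i leis xs sx].
  rewrite expr0 mul1r mulr_gt0 //; first by rewrite subr_gt0 (sx 0%N).
  by rewrite -[_.[x]]mul1r (IHs 0%N) // => j /andP[_ ltjs]; apply: (sx j.+1).
rewrite exprS mulN1r -mulN1r mulrACA mulN1r opprB mulr_gt0 ?subr_gt0 ?(xs 0%N) //.
by apply: IHs => // j; [apply: (xs j.+1) | apply: (sx j.+1)].
Qed.

(** The intermediate value theorem gives a zero in each gap. Dropping the first point flips all
    signs, hence the induction hypothesis is used for [- p]. *)
Lemma alternating_roots (R : rcfType) (p : {poly R}) (c : seq R) :
  (forall i, (i.+1 < size c)%N -> c`_i.+1 < c`_i) ->
  (forall i, (i < size c)%N -> 0 < (-1) ^+ i * p.[c`_i]) ->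
  exists s, [/\ size s = (size c).-1, all (root p) s &
    forall i, (i < size s)%N -> c`_i.+1 < s`_i < c`_i].
Proof.
elim: c p => [|a [|b c] IHc] p cdec csgn; try by exists [::].
have [|i ltic|s [szs rts ins]] := IHc (- p).
- by move=> i ltic; apply: (cdec i.+1).
- by rewrite hornerN mulrN -mulNr -mulN1r -exprS; apply: (csgn i.+1).
have leba : b <= a by apply/ltW/(cdec 0%N).
have : p.[b] * p.[a] < 0.
  have := csgn 0%N isT; have := csgn 1%N isT; rewrite /= expr0 expr1 => ? ?; nra.
case/(poly_ivtoo leba) => x; rewrite in_itv /= => xin px.
exists (x :: s); split=> /=; first by rewrite szs.
- by rewrite px; apply: sub_all rts => y; rewrite rootN.
by case=> [|i] lti //=; apply: ins.
Qed.

Lemma sorted_gt_nth (R : rcfType) (s : seq R) :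
  (forall i, (i.+1 < size s)%N -> s`_i.+1 < s`_i) -> sorted >%O s.
Proof. by move=> sdec; apply/(sortedP 0). Qed.

(** The zeros lie in disjoint gaps, so they are distinct, and there are as many as the degree. *)
Lemma alternating_factorization (R : rcfType) (p : {poly R}) (c : seq R) :
  size p = size c ->
  (forall i, (i.+1 < size c)%N -> c`_i.+1 < c`_i) ->
  (forall i, (i < size c)%N -> 0 < (-1) ^+ i * p.[c`_i]) ->
  exists s, [/\ size s = (size c).-1,
    p = lead_coef p *: \prod_(a <- s) ('X - a%:P) &
    forall i, (i < size s)%N -> c`_i.+1 < s`_i < c`_i].
Proof.
move=> szp cdec csgn; have [s [szs rts ins]] := alternating_roots cdec csgn.
exists s; split=> //; case: c => [|a c] in szp cdec csgn szs ins *.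
  have /eqP := szp; rewrite size_poly_eq0 => /eqP->.
  by rewrite lead_coef0 scale0r.
apply: all_roots_prod_XsubC => //; first by rewrite szp szs.
rewrite uniq_rootsE; apply/(@sorted_uniq _ >%O); try exact: lt_trans.
- by move=> x y z yx zy; apply: lt_trans zy yx.
- by move=> x /=; rewrite ltxx.
apply: sorted_gt_nth => i ltis.
have /andP[_ lt1] := ins _ ltis.
by have /andP[+ _] := ins _ (ltnW ltis); apply: lt_trans.
Qed.

Lemma sign_minfty (R : rcfType) (p : {poly R}) (x : R) :
  0 < lead_coef p ->
  exists2 y, y < x & 0 < (-1) ^+ (size p).-1 * p.[y].
Proof.
(* Reflection reduces to plus infinity, with the sign chosen to keep the leading coefficient. *)
move=> lp; pose q := (-1) ^+ (size p).-1 *: (p \Po - 'X).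
have lq : lead_coef q = lead_coef p.
  rewrite lead_coefZ lead_coef_comp ?size_polyN ?size_polyX //.
  by rewrite lead_coefN lead_coefX mulrCA -exprMn mulrNN mulr1 expr1n mulr1.
have [|N NP] := @poly_pinfty_gt_lc _ q; first by rewrite lq.
exists (- Num.max N (1 - x)).
  have : 1 - x <= Num.max N (1 - x) by rewrite le_max lexx orbT.
  lra.
have : lead_coef q <= q.[Num.max N (1 - x)] by apply: NP; rewrite le_max lexx.
rewrite lq hornerZ horner_comp hornerN hornerX; exact: lt_le_trans.
Qed.

Lemma nth_decreasing (R : rcfType) (c : seq R) (i j : nat) :
  (forall i, (i.+1 < size c)%N -> c`_i.+1 < c`_i) ->
  (i <= j < size c)%N -> c`_j <= c`_i.
Proof.
move=> cdec /andP[]; elim: j => [|j IHj]; first by rewrite leqn0 => /eqP->.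
rewrite leq_eqVlt => /predU1P[->//|leij] ltjc.
exact: le_trans (ltW (cdec _ ltjc)) (IHj leij (ltnW ltjc)).
Qed.

(** * Induction along the recurrence *)

(** Comparison with [0 :: s] makes [s] both negative and strictly decreasing. The last clause
    encodes interlacing with the previous polynomial by signs; at [r = 0] it is vacuous, as [s] is
    empty. *)
Definition Sturm_zeros (R : rcfType) (k r : nat) (s : seq R) : Prop :=
  [/\ size s = minn r k,
      Wred R k r = lead_coef (Wred R k r) *: \prod_(a <- s) ('X - a%:P),
      forall i, (i < size s)%N -> s`_i < (0 :: s)`_i &
      forall i, (i < size s)%N -> 0 < (-1) ^+ i * (Wred R k r.-1).[s`_i]].

Lemma Sturm_step (R : rcfType) (k r : nat) (s : seq R) :
  Sturm_zeros k r s ->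
  exists2 t, Sturm_zeros k r.+1 t &
    (forall i, (i < size s)%N -> s`_i < t`_i) /\
    (forall i, (i < size t)%N -> t`_i < (0 :: s)`_i).
Proof.
case=> szs Qs sdec ssgn.
have sgn0 : 0 < (-1) ^+ 0 * (Wred R k r.+1).[0].
  by rewrite mul1r horner_coef0 coef_Wred ltr0n muln_gt0 !bin_gt0.
(* At a zero of the middle polynomial only the term with the factor [x - 1 < 0] survives, which
   reverses the sign. *)
have sgnS i : (i < size s)%N -> 0 < (-1) ^+ i.+1 * (Wred R k r.+1).[s`_i].
  move=> ltis; case: r => [|r] in szs Qs ssgn sgn0 *; first by rewrite szs min0n in ltis.
  have rt : (Wred R k r.+1).[s`_i] = 0.
    by apply/rootP; rewrite Qs rootZ ?gt_eqF ?lead_coef_Wred_gt0 // root_prod_XsubC mem_nth.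
  have s_lt0 : s`_i < 0.
    have : (0 :: s)`_i.+1 <= (0 :: s)`_1.
      by apply: nth_decreasing => [j|]; [apply: sdec | rewrite /= ltnS].
    by move/le_lt_trans; apply; apply: (sdec 0%N); lia.
  have := congr1 (fun p : {poly R} => p.[s`_i]) (Wred_rec R k r).
  rewrite /= !(hornerE, rt) /= => rec.
  have r3 : 0 < r.+3%:R :> R by rewrite ltr0n.
  have r1 : 0 < r.+1%:R :> R by rewrite ltr0n.
  rewrite -(pmulr_rgt0 _ r3) mulrCA rec exprS.
  rewrite [X in 0 < X](_ : _ = r.+1%:R * (1 - s`_i) * ((-1) ^+ i * (Wred R k r).[s`_i])); last ring.
  by rewrite mulr_gt0 ?ssgn // mulr_gt0 //; lra.
(* While the degree grows, that is for [r < k], one more point far to the left is needed; afterwards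
   [0 :: s] suffices. *)
have [e [sze edec esgn]] : exists e, let c := (0 :: s) ++ e in
    [/\ size (Wred R k r.+1) = size c, forall i, (i.+1 < size c)%N -> c`_i.+1 < c`_i &
        forall i, (i < size c)%N -> 0 < (-1) ^+ i * (Wred R k r.+1).[c`_i]].
  have [lekr|ltrk] := leqP k r.
    exists [::]; rewrite cats0; split=> //; last by case.
    by rewrite size_Wred /= szs; lia.
  have [y ylt ysgn] := sign_minfty (last 0 s) (lead_coef_Wred_gt0 R k r.+1).
  exists [:: y]; rewrite cats1; split.
  - by rewrite size_Wred size_rcons /= szs; lia.
  - move=> i; rewrite size_rcons ltnS /= => ltis; rewrite -rcons_cons !nth_rcons [size (0 :: s)]/=.
    rewrite ltis /=; move: ltis; rewrite ltnS; case: ltngtP => //= [ltis _|-> _]; first exact: sdec.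
    by rewrite nth_last.
  move=> i; rewrite size_rcons ltnS /= => leis; rewrite -rcons_cons nth_rcons /=.
  case: ltngtP leis => //= [ltis _|-> _]; last first.
    by have := ysgn; rewrite size_Wred /= szs (_ : minn r.+1 k = (minn r k).+1) //; lia.
  by case: i ltis => [|i] ltis //; apply: sgnS.
have [t [szt Qt tin]] := alternating_factorization sze edec esgn.
have szt' : size t = minn r.+1 k by rewrite szt -sze size_Wred.
have cs i : (i <= size s)%N -> ((0 :: s) ++ e)`_i = (0 :: s)`_i.
  by move=> leis; rewrite nth_cat /= ltnS leis.
have lest : (size s <= size t <= (size s).+1)%N by rewrite szs szt'; lia.
have st i : (i < size s)%N -> s`_i < t`_i.
  by move=> ltis; have /andP[+ _] := tin i ltac:(lia); rewrite cs.
have ts i : (i < size t)%N -> t`_i < (0 :: s)`_i.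
  by move=> ltit; have /andP[_ +] := tin i ltit; rewrite cs; last lia.
exists t => //; split=> // [[|i] ltit|i ltit].
- exact: (ts 0%N).
- have ltis : (i < size s)%N by case/andP: lest => _ /(leq_trans ltit).
  exact: lt_trans (ts _ ltit) (st _ ltis).
(* Exactly [i] entries of [s] lie above the zero of index [i] in [t], which gives the sign. *)
rewrite [r.+1.-1]/= Qs hornerZ mulrCA mulr_gt0 ?lead_coef_Wred_gt0 //.
have dec a b : (a <= b < (size s).+1)%N -> (0 :: s)`_b <= (0 :: s)`_a.
  by move=> ab; apply: nth_decreasing => // j; apply: sdec.
have leis : (i <= size s)%N by case/andP: lest => _ /(leq_trans ltit).
apply: prod_XsubC_sign => //.
  move=> j ltji; apply: lt_le_trans (ts _ ltit) (dec j.+1 i _).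
  by rewrite ltji ltnS.
move=> j /andP[leij ltjs].
apply: le_lt_trans (dec i.+1 j.+1 _) (st _ (leq_ltn_trans leij ltjs)).
by rewrite !ltnS leij.
Qed.

Lemma Sturm_zeros_exists (R : rcfType) (k r : nat) :
  exists s, @Sturm_zeros R k r s.
Proof.
elim: r => [|r [s /Sturm_step[t tz _]]]; last by exists t.
exists [::]; split=> //; first by rewrite min0n.
by apply: all_roots_prod_XsubC; rewrite ?size_Wred ?min0n.
Qed.

(** * Transfer to the polynomials [W] *)

Lemma coef_W (R : rcfType) (n k m : nat) :
  (W R n k)`_m = if (m <= k)%N then (w n k m)%:R else 0.
Proof. by rewrite /W big_mkord -(poly_def _ (fun m => (w n k m)%:R)) coef_poly ltnS. Qed.

Lemma W_diag (R : rcfType) (k : nat) : W R k.+1 k.+1 = 1.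
Proof.
apply/polyP => m; rewrite coef_W coef1.
have := @w_formula k.+1 k.+1 m; rewrite !leqnn => /(_ isT).
rewrite /ncomp2 ltnn subnn /= binSn => /eqP; rewrite eqn_pmul2l // => /eqP ->.
by case: m => [|m]; rewrite ?bin0 //= muln0 if_same.
Qed.

(** With more U's than peaks some ascent is long, so [m = 0] does not occur and ['X] splits off. *)
Lemma W_Wred (R : rcfType) (k r : nat) :
  W R (k.+1 + r.+1) k.+1 =
  ('C(k.+1 + r.+1, k)%:R / k.+1%:R) *: ('X * Wred R k r).
Proof.
set n := (k.+1 + r.+1)%N; apply/polyP => m.
have k1 : k.+1%:R != 0 :> R by rewrite pnatr_eq0.
rewrite coef_W coefZ coefXM.
have wE : (k.+1 * w n k.+1 m = 'C(n, k) * ('C(k.+1, m) * ncomp r.+1 m))%N.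
  rewrite w_formula /n ?leq_addr // /ncomp2 /= ifN -?leqNgt ?leq_addr //.
  by rewrite addnC addnK.
have wER : (w n k.+1 m)%:R =
    'C(n, k)%:R / k.+1%:R * ('C(k.+1, m) * ncomp r.+1 m)%:R :> R.
  apply: (mulfI k1); rewrite -natrM wE natrM.
  by rewrite mulrAC [RHS]mulrC mulfVK.
case: m => [|m] /= in wE wER *.
  by rewrite wER muln0.
rewrite coef_Wred -wER; case: leqP => // ltkm.
by rewrite wER (@bin_small k.+1) ?ltnS // mul0n mulr0.
Qed.

Lemma nonneg_coefs_W (R : rcfType) (n k : nat) : nonneg_coefs (W R n k).
Proof. by move=> m; rewrite coef_W; case: leqP. Qed.

Lemma W_Sturm_zeros (R : rcfType) (k r : nat) (s : seq R) :
  Sturm_zeros k r s ->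
  [/\ size (W R (k.+1 + r.+1) k.+1) = (size s).+2,
      W R (k.+1 + r.+1) k.+1 != 0 &
      zeros_of (W R (k.+1 + r.+1) k.+1) (0 :: s)].
Proof.
case=> szs Qs sdec _; rewrite W_Wred; set c := _ / _.
have c_neq0 : c != 0.
  by rewrite mulf_neq0 ?invr_eq0 ?pnatr_eq0 // -lt0n bin_gt0 addSnnS leq_addr.
have Wred_neq0 : Wred R k r != 0 by rewrite -size_poly_eq0 size_Wred.
split.
- by rewrite size_scale // mulrC size_mulX // size_Wred szs.
- by rewrite scaler_eq0 negb_or c_neq0 mulf_neq0 ?polyX_eq0.
split; first by apply/(sortedP 0) => i ltis; apply/ltW/sdec.
rewrite lead_coefZ lead_coefM lead_coefX mul1r big_cons subr0.
by rewrite -[RHS]scalerA (scalerAr (lead_coef _)) -Qs.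
Qed.
Theorem theorem2p4 (R : rcfType) (k : nat) (hk : (1 <= k)%N) :
  generalized_Sturm k (fun n => W R n k).
Proof.
case: k hk => // k _; split=> n; rewrite leq_eqVlt => /predU1P[<-|ltkn].
- rewrite W_diag; exists [::]; split=> //.
  by rewrite big_nil lead_coef1 scale1r.
- have [s sz] := Sturm_zeros_exists R k (n - k.+2).
  exists (0 :: s); have [_ _] := W_Sturm_zeros sz.
  by rewrite (_ : k.+1 + (n - k.+2).+1 = n)%N //; lia.
(* The convention for a constant and a linear polynomial; the last factor [k.+1] is the constant
   [Wred R k 0]. *)
- apply: Or42; exists 1, (('C(k.+2, k)%:R / k.+1%:R) * k.+1%:R), 0.
  rewrite W_diag; split=> //; rewrite -[k.+2]addn1 W_Wred addn1 addr0 -[RHS]scalerA.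
  congr (_ *: _); apply/polyP => j; rewrite coefXM coef_Wred coefZ coefX.
  by case: j => [|[|j]]; rewrite ?mulr0 //= ?bin1 ?muln1 ?mulr1 // muln0.
have [s sz] := Sturm_zeros_exists R k (n - k.+2).
have [t tz [st ts]] := Sturm_step sz.
have [szG G0 Gz] := W_Sturm_zeros sz; have [szF F0 Fz] := W_Sturm_zeros tz.
have eG : (k.+1 + (n - k.+2).+1 = n)%N by lia.
have eF : (k.+1 + (n - k.+2).+2 = n.+1)%N by lia.
rewrite eG in szG G0 Gz; rewrite eF in szF F0 Fz.
apply: Or41; split=> //; try exact: nonneg_coefs_W; split.
  rewrite szF szG; have [-> _ _ _] := sz; have [-> _ _ _] := tz.
  by have [|] := leqP k (n - k.+2) => ?; [left|right]; lia.
(* The common zero 0 heads both lists and shifts indices by one, so the two bounds of [Sturm_step]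
   become the two chains. *)
exists (0 :: t), (0 :: s); split=> //.
  by case=> [|i] ltis //=; apply/ltW/st.
by move=> i ltit /=; apply/ltW/ts.
Qed.
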